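(* Let $\sigma>0$, let $f(y)=\frac{1}{y\sigma\sqrt{2\pi}}e^{-(\log y)^2/(2\sigma^2)}$ ($y>0$) be the lognormal$(0,\sigma^2)$ density, $\mathcal{L}(\theta)=\int_0^\infty e^{-\theta y}f(y)\,dy$ its Laplace transform and $\kappa=\log\mathcal{L}$. For $\theta\ge 0$ let $F_\theta$ be the distribution with density $e^{-\theta y-\kappa(\theta)}f(y)$, $y>0$. Fix $x$ with $0<x<e^{\sigma^2/2}$ and let $\theta(x)>0$ be the solution of $-\kappa'(\theta(x))=x$, i.e. the mean of $F_{\theta(x)}$ equals $x$. For $n\ge1$ let $X_1,\dots,X_n$ be i.i.d. with distribution $F_{\theta(x)}$, $S_n=X_1+\dots+X_n$, and define $$\beta_n(x)=\mathcal{L}^n(\theta(x))\,e^{\theta(x)S_n}\,\mathbf{1}\{S_n<nx\}.$$ Let $\alpha_n(x)=\mathbb{P}(S_n'\le nx)$ where $S_n'$ is a sum of $n$ i.i.d. lognormal$(0,\sigma^2)$ random variables. Then $\beta_n(x)$ is an unbiased estimator of $\alpha_n(x)$ (i.e. $\mathbb{E}[\beta_n(x)]=\alpha_n(x)$ for every $n$), and it is logarithmically efficient as $n\to\infty$: for every $\epsilon>0$, $$\limsup_{n\to\infty}\frac{\mathrm{Var}\,\beta_n(x)}{\alpha_n(x)^{2-\epsilon}}=0.$$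
   Context: $e^{\sigma^2/2}$ is the mean of the lognormal$(0,\sigma^2)$ distribution; for $0<x<e^{\sigma^2/2}$ the equation $-\kappa'(\theta)=x$ has a unique solution $\theta(x)>0$ (the Cramér function). *)

(* Defs.v *)
From HB Require Import structures.
From mathcomp Require Import all_boot all_order all_algebra.
From mathcomp Require Import all_classical all_reals all_analysis.
Set Implicit Arguments. Unset Strict Implicit. Unset Printing Implicit Defensive.
Import Order.TTheory GRing.Theory Num.Theory.
Import numFieldNormedType.Exports.
Local Open Scope classical_set_scope.
Local Open Scope ring_scope.

Section defs.
Context {R : realType}.

Definition lognormal_pdf (sigma : R) (y : R) : R :=
  if 0 < y then
    expR (- (ln y) ^+ 2 / (sigma ^+ 2 *+ 2)) / (y * sigma * Num.sqrt (pi *+ 2))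
  else 0.

Definition laplace (sigma theta : R) : R :=
  fine (\int[lebesgue_measure]_(y in [set y : R | (0 < y)%R])
          (expR (- (theta * y)) * lognormal_pdf sigma y)%:E)%E.

Definition kappa (sigma theta : R) : R := ln (laplace sigma theta).

Definition tilted_pdf (sigma theta : R) (y : R) : R :=
  if 0 < y then expR (- (theta * y) - kappa sigma theta) * lognormal_pdf sigma y
  else 0.

Definition has_density d (T : measurableType d) (P : probability T R)
  (X : {RV P >-> R}) (g : R -> R) : Prop :=
  forall B : set R, measurable B ->
    distribution P X B = (\int[lebesgue_measure]_(y in B) (g y)%:E)%E.

Definition mutually_independent d (T : measurableType d) (P : probability T R)
  (X : nat -> {RV P >-> R}) : Prop :=
  forall (I : seq nat) (B : nat -> set R), uniq I ->
    (forall i, measurable (B i)) ->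
    P (\big[setI/setT]_(i <- I) (X i @^-1` B i)) =
    (\prod_(i <- I) P (X i @^-1` B i))%E.

Definition iid_density d (T : measurableType d) (P : probability T R)
  (X : nat -> {RV P >-> R}) (g : R -> R) : Prop :=
  mutually_independent X /\ forall i, has_density (X i) g.

Definition partial_sum (T : Type) (X : nat -> T -> R) (n : nat) (w : T) : R :=
  \sum_(i < n) X i w.

Definition beta_est (T : Type) (sigma theta x : R) (X : nat -> T -> R)
  (n : nat) (w : T) : R :=
  laplace sigma theta ^+ n * expR (theta * partial_sum X n w)
  * ((partial_sum X n w < n%:R * x)%R : bool)%:R.

End defs.

(* Main.v *)
(* Under the tilted law P, Q(S_n in A) = L(theta)^n E_P[e^(theta S_n); S_n in A]
   by induction on n, through the convolution structure of the laws of partial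
   sums; this is unbiasedness, the sums being atomless.

   Put rho = kappa(theta) + theta x. On {S_n < n x} the estimator is at most
   e^(n rho), so its variance is at most e^(2 n rho). Conversely
   alpha_n >= e^(n (rho - eta)) eventually, for every eta > 0. No central limit
   theorem is needed for this: Chernoff's bound and the mere differentiability
   of kappa at theta concentrate S_k around k x, and forcing a small fraction of
   the variables below x / 2 moves the sum just below n x, an event of
   probability at least e^(-eta n).
   Since rho < 0, by strict convexity of the moment generating function of X - x,
   the ratio decays geometrically for every eps > 0. *)
Require Import Defs.
From HB Require Import structures.
From mathcomp Require Import all_boot all_order all_algebra.
From mathcomp Require Import all_classical all_reals all_analysis.
From mathcomp Require Import measurable_realfun ring lra zify.
Import Order.TTheory GRing.Theory Num.Theory.
Import numFieldNormedType.Exports.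
Local Open Scope classical_set_scope.
Local Open Scope ring_scope.
Local Open Scope ereal_scope.

(** * Integration against a measure given by a density *)

Section density.
Import HBNNSimple.

(** Monotone convergence along simple functions reduces the identity to the level sets of [f_ n],
    where the hypothesis on [nu] applies directly. *)
Lemma ge0_integral_density d (T : measurableType d) (R : realType)
    (mu nu : {measure set T -> \bar R}) (g : T -> R) (f : T -> \bar R) :
  measurable_fun setT g -> (forall y, (0 <= g y)%R) ->
  (forall B, measurable B -> nu B = \int[mu]_(y in B) (g y)%:E) ->
  measurable_fun setT f -> (forall y, 0 <= f y) ->
  \int[nu]_y f y = \int[mu]_y (f y * (g y)%:E).
Proof.
move=> mg g0 nuE mf f0.
have mgE : measurable_fun setT (EFin \o g) by exact/measurable_EFinP.
pose f_ := nnsfun_approx measurableT mf.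
transitivity (limn (fun n => \int[nu]_x (f_ n x)%:E)).
  rewrite -monotone_convergence//.
  - by apply: eq_integral => y _; apply/esym/cvg_lim => //; exact: cvg_nnsfun_approx.
  - by move=> n; exact/measurable_EFinP.
  - by move=> n y _; rewrite lee_fin.
  - by move=> y _ m n mn; rewrite lee_fin; exact/lefP/nd_nnsfun_approx.
transitivity (limn (fun n => \int[mu]_x ((f_ n x)%:E * (g x)%:E))); last first.
  rewrite -monotone_convergence//.
  - apply: eq_integral => y _; apply/cvg_lim => //; apply: cvgeZr => //.
    exact: cvg_nnsfun_approx.
  - by move=> n; apply: emeasurable_funM => //; exact/measurable_EFinP.
  - by move=> n y _; rewrite mule_ge0 ?lee_fin.
  - move=> y _ m n mn; rewrite lee_wpmul2r ?lee_fin//.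
    exact/lefP/nd_nnsfun_approx.
congr (limn _); apply/funext => n.
transitivity (\sum_(k \in range (f_ n)) (k%:E * nu (f_ n @^-1` [set k]))).
  by rewrite integralT_nnsfun sintegralE.
transitivity (\int[mu]_x
    (\sum_(k \in range (f_ n)) (k%:E * ((\1_(f_ n @^-1` [set k]) x)%:E * (g x)%:E)))).
  rewrite ge0_integral_fsum//.
  - apply: eq_fsbigr => k /[!inE] -[t _ <-].
    rewrite ge0_integralZl//=.
    + rewrite nuE//; congr (_ * _).
      rewrite integral_mkcond; apply: eq_integral => x _.
      rewrite patchE indicE; case: ifPn => _; by rewrite ?mul1e ?mul0e.
    + by apply: emeasurable_funM => //; exact/measurable_EFinP.
    + by move=> x _; rewrite mule_ge0 ?lee_fin.
    + by rewrite lee_fin.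
  - move=> r; apply: measurable_funeM; apply: emeasurable_funM => //.
    exact/measurable_EFinP.
  - move=> r x _; rewrite muleA mule_ge0 ?lee_fin//.
    exact: nnfun_muleindic_ge0.
apply: eq_integral => x _.
under eq_fsbigr do rewrite muleA -EFinM.
rewrite (@fimfunE _ _ (f_ n) x) -fsumEFin// ge0_mule_fsuml// => r.
exact: nnfun_muleindic_ge0.
Qed.

End density.

(** * Laws of partial sums of independent variables *)

Section independent_sums.
Context {R : realType} d (T : measurableType d) (P : probability T R).
Variable X : nat -> {RV P >-> R}.

Lemma measurable_partial_sum n :
  measurable_fun setT (partial_sum (fun i => X i : T -> R) n).
Proof. exact: measurable_sum. Qed.

HB.instance Definition _ n := isMeasurableFun.Build _ _ _ _
  (partial_sum (fun i => X i : T -> R) n) (measurable_partial_sum n).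

Let S n : {RV P >-> R} := partial_sum (fun i => X i : T -> R) n.

Lemma partial_sumS n w : partial_sum (fun i => X i : T -> R) n.+1 w =
  (partial_sum (fun i => X i : T -> R) n w + X n w)%R.
Proof. by rewrite /partial_sum big_ord_recr. Qed.

Lemma measurable_bigcap_preimage (I : seq nat) (B : nat -> set R) :
  (forall i, measurable (B i)) ->
  measurable (\big[setI/setT]_(i <- I) (X i @^-1` B i)).
Proof.
by move=> mB; apply: bigsetI_measurable => i _; exact: measurable_funPTI.
Qed.

Hypothesis indep : mutually_independent X.

Let pair n w := (S n w, X n w).

Let mpair n : measurable_fun setT (pair n).
Proof. exact/measurable_fun_pair. Qed.

HB.instance Definition _ n := isMeasurableFun.Build _ _ _ _ (pair n) (mpair n).

Let madd (A : set R) : measurable A -> measurable [set z : R * R | A (z.1 + z.2)%R].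
Proof.
move=> mA; have mD : measurable_fun [set: R * R] (fun z => z.1 + z.2)%R.
  by apply: measurable_funD.
by have := mD measurableT _ mA; rewrite setTI.
Qed.

(* The joint statement with the later coordinates is what makes the induction
   on [n] go through. *)
Lemma independent_partial_sum n (A : set R) (I : seq nat) (B : nat -> set R) :
  measurable A -> uniq I -> all (leq n) I -> (forall i, measurable (B i)) ->
  P (partial_sum (fun i => X i : T -> R) n @^-1` A `&`
     \big[setI/setT]_(i <- I) (X i @^-1` B i)) =
  P (partial_sum (fun i => X i : T -> R) n @^-1` A) *
  \prod_(i <- I) P (X i @^-1` B i).
Proof.
rewrite -/(S n).
elim: n A I B => [|n IH] A I B mA uI nI mB.
  have S0 w : S 0 w = 0%R by rewrite /S/= /partial_sum big_ord0.
  have [A0|A0] := pselect (A 0%R).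
    have -> : S 0 @^-1` A = setT.
      by apply/seteqP; split => w //= _; rewrite S0.
    by rewrite setTI probability_setT mul1e indep.
  have -> : S 0 @^-1` A = set0.
    by apply/seteqP; split => w //=; rewrite S0.
  by rewrite set0I measure0 mul0e.
have nI' : all (leq n) I by apply: sub_all nI => i; exact: ltnW.
have nnI : n \notin I.
  by apply/negP => /(allP nI); rewrite ltnn.
set E := \big[setI/setT]_(i <- I) (X i @^-1` B i).
have mE : measurable E by exact: measurable_bigcap_preimage.
have PE_ge0 : (0 <= fine (P E))%R by apply: fine_ge0.
have PEE : (fine (P E))%:E = P E by rewrite fineK// fin_num_measure.
have PprodE : \prod_(i <- I) P (X i @^-1` B i) = P E by rewrite indep.
(* Prepending the index [n] to [I], with event [D], gives the three-fold factorisation. *)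
have IHX C D : measurable C -> measurable D ->
    P (S n @^-1` C `&` X n @^-1` D `&` E) = P (S n @^-1` C) * P (X n @^-1` D) * P E.
  move=> mC mD; pose B' i := if i == n then D else B i.
  have mB' i : measurable (B' i) by rewrite /B'; case: ifP.
  have := IH C (n :: I) B' mC; rewrite /= nnI uI nI' leqnn => /(_ isT isT mB').
  rewrite !big_cons /B' eqxx -muleA -setIA -PprodE.
  have iI i : i \in I -> (if i == n then D else B i) = B i.
    by move=> iI; case: eqP iI nnI => // -> ->.
  rewrite big_seq; under eq_bigr => i /iI -> do [].
  by rewrite -big_seq; under [in RHS]eq_big_seq => i /iI -> do [].
(* The law of [pair n] restricted to [E] and the law of [pair n] scaled by [P E] agree on
   rectangles, hence on all measurable sets of the plane, in particular on the pairs with sum in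
   [A]. *)
pose m1 : {finite_measure set R -> \bar R} :=
  mscale (NngNum PE_ge0) (distribution P (S n)).
pose m2 : {finite_measure set R -> \bar R} := distribution P (X n).
pose ma' : {measure set (R * R) -> \bar R} :=
  pushforward (mrestr P mE) (pair n).
pose ma := ma' (mpair n).
pose mb : {measure set (R * R) -> \bar R} :=
  mscale (NngNum PE_ge0) (distribution P (pair n)).
have pairI (C D : set R) : pair n @^-1` (C `*` D) = S n @^-1` C `&` X n @^-1` D.
  by [].
have IHXT C D : measurable C -> measurable D ->
    P (S n @^-1` C `&` X n @^-1` D) = P (S n @^-1` C) * P (X n @^-1` D).
  move=> mC mD; have := IH C [:: n] (fun=> D) mC isT.
  by rewrite /= leqnn !big_seq1; exact.
have maE C D : measurable C -> measurable D -> ma (C `*` D) = m1 C * m2 D.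
  move=> mC mD; rewrite /ma /= /pushforward /mrestr pairI IHX//.
  by rewrite /m1/= /mscale/= PEE muleC muleA.
have mbE C D : measurable C -> measurable D -> mb (C `*` D) = m1 C * m2 D.
  move=> mC mD; rewrite /mb /= /mscale/= /distribution /pushforward pairI IHXT//.
  by rewrite /m1/= /mscale/= muleA.
have := product_measure_unique maE (madd _ mA).
rewrite (product_measure_unique mbE (madd _ mA)).
rewrite PprodE /ma /mb /= /mscale /= /distribution /pushforward /mrestr PEE.
have -> : pair n @^-1` [set z | A (z.1 + z.2)%R] = S n.+1 @^-1` A.
  by apply/seteqP; split => w /=; rewrite partial_sumS.
by move=> <-; rewrite muleC.
Qed.

(** The joint law of [S n] and [X n] is the product of their laws, so Tonelli's theorem splits the
    integral. *)
Lemma ge0_integral_partial_sumS n (h : R -> \bar R) :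
  measurable_fun setT h -> (forall s, 0 <= h s) ->
  \int[P]_w h (partial_sum (fun i => X i : T -> R) n.+1 w) =
  \int[P]_w \int[P]_w' h (partial_sum (fun i => X i : T -> R) n w + X n w')%R.
Proof.
move=> mh h0.
have mD : measurable_fun [set: R * R] (fun z => z.1 + z.2)%R by apply: measurable_funD.
pose k (z : R * R) := h (z.1 + z.2)%R.
have mk : measurable_fun setT k by exact: measurableT_comp.
have k0 z : 0 <= k z by exact: h0.
transitivity (\int[distribution P (pair n)]_z k z).
  rewrite ge0_integral_distribution//; apply: eq_integral => w _ /=.
  by rewrite partial_sumS.
transitivity (\int[distribution P (S n) \x distribution P (X n)]_z k z).
  apply: eq_measure_integral => C mC _; symmetry.
  apply: product_measure_unique => // A B mA mB.
  have := @independent_partial_sum n A [:: n] (fun=> B) mA isT.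
  by rewrite /= leqnn !big_seq1; exact.
rewrite fubini_tonelli1// ge0_integral_distribution//.
- apply: eq_integral => w _ /=; rewrite /fubini_F/=.
  by rewrite ge0_integral_distribution//; exact: measurable_fun_pair2.
- exact: measurable_fun_fubini_tonelli_F.
- by move=> y; apply: integral_ge0.
Qed.

End independent_sums.

(** * The lognormal density and its tilted versions *)

Section lognormal.
Context {R : realType} {sigma : R}.
Hypothesis sigma_gt0 : (0 < sigma)%R.

Lemma lognormal_pdf_gt0 y : (0 < y)%R -> (0 < lognormal_pdf sigma y)%R.
Proof.
move=> y0; rewrite /lognormal_pdf y0 divr_gt0 ?expR_gt0//.
by rewrite !mulr_gt0// sqrtr_gt0 pmulrn_lgt0// pi_gt0.
Qed.

Lemma lognormal_pdf_ge0 y : (0 <= lognormal_pdf sigma y)%R.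
Proof.
have [/lognormal_pdf_gt0/ltW//|y0] := ltP 0%R y.
by rewrite /lognormal_pdf ltNge y0.
Qed.

Lemma measurable_lognormal_pdf : measurable_fun setT (lognormal_pdf sigma).
Proof.
(* Writing 1/y as e^(-ln y) for y > 0 leaves only products and compositions of measurable
   functions. *)
rewrite [X in measurable_fun _ X](_ : _ = fun y => if (0 < y)%R then
    (expR (- (ln y) ^+ 2 / (sigma ^+ 2 *+ 2)) *
      (expR (- ln y) / (sigma * Num.sqrt (pi *+ 2))))%R else 0%R); last first.
  apply/funext => y; rewrite /lognormal_pdf; case: ifPn => // y0.
  by rewrite expRN lnK ?posrE// -mulrA invfM.
apply: measurable_fun_ifT => //=; first exact: measurable_fun_ltr.
apply: measurable_funM.
  apply: measurableT_comp => //; apply: measurable_funM => //.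
  by apply: measurableT_comp => //; apply: measurable_funX; exact: measurable_ln.
apply: measurable_funM => //; apply: measurableT_comp => //.
by apply: measurableT_comp => //; exact: measurable_ln.
Qed.

Lemma tilted_pdf_ge0 theta y : (0 <= tilted_pdf sigma theta y)%R.
Proof.
rewrite /tilted_pdf; case: ifPn => // _.
by rewrite mulr_ge0 ?expR_ge0 ?lognormal_pdf_ge0.
Qed.

Lemma tilted_pdf_gt0 theta y : (0 < y)%R -> (0 < tilted_pdf sigma theta y)%R.
Proof.
by move=> y0; rewrite /tilted_pdf y0 mulr_gt0 ?expR_gt0 ?lognormal_pdf_gt0.
Qed.

Lemma measurable_tilted_pdf theta : measurable_fun setT (tilted_pdf sigma theta).
Proof.
apply: measurable_fun_ifT => //=; first exact: measurable_fun_ltr.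
apply: measurable_funM; last exact: measurable_lognormal_pdf.
apply: measurableT_comp => //; apply: measurable_funB => //.
by apply: measurableT_comp => //; exact: measurable_funM.
Qed.

(** A zero integral would make [g] vanish almost everywhere on the interval, which would then be a
    null set. *)
Lemma integral_itvoo_gt0 (g : R -> R) (b : R) : (0 < b)%R ->
  measurable_fun setT g -> (forall y, (0 < y)%R -> (0 < g y)%R) ->
  0 < \int[lebesgue_measure]_(y in `]0%R, b[) (g y)%:E.
Proof.
move=> b0 mg g0; have D0 y : `]0%R, b[%classic y -> (0 < y)%R.
  by rewrite /= in_itv/= => /andP[].
rewrite lt0e integral_ge0 ?andbT; last by move=> y /D0/g0/ltW; rewrite lee_fin.
apply/negP => /eqP int0.
have mgE : measurable_fun `]0%R, b[ (EFin \o g).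
  by apply: measurable_funTS; exact/measurable_EFinP.
have [+ _] := ae_eq_integral_abs lebesgue_measure (measurable_itv `]0%R, b[) mgE.
rewrite (_ : (\int[_]_(_ in _) _) = 0); last first.
  rewrite -int0; apply: eq_integral => y /[!inE] /D0/g0 gy.
  by rewrite /= ger0_norm// ltW.
move=> /(_ erefl) [N [mN N0 sub]].
have : lebesgue_measure `]0%R, b[%classic <= lebesgue_measure N.
  rewrite le_measure ?inE//; apply: subset_trans sub => y Dy /=.
  by move=> /(_ Dy) [] /eqP; rewrite gt_eqF// g0//; exact: D0.
rewrite N0 lebesgue_measure_itv/= lte_fin b0 oppr0 adde0 lee_fin.
by rewrite leNgt b0.
Qed.

Lemma integral_laplace theta :
  \int[lebesgue_measure]_(y in [set y : R | (0 < y)%R])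
    (expR (- (theta * y)) * lognormal_pdf sigma y)%:E =
  \int[lebesgue_measure]_y (expR (- (theta * y)) * lognormal_pdf sigma y)%:E.
Proof.
rewrite integral_mkcond; apply: eq_integral => y _; rewrite patchE.
case: ifPn => //; rewrite notin_setE/= => /negP y0.
by rewrite /lognormal_pdf (negbTE y0) mulr0.
Qed.

End lognormal.

(** * Expectations as Lebesgue integrals against a density *)

Lemma ge0_integral_has_density {R : realType} d (T : measurableType d)
    (P : probability T R) (X : {RV P >-> R}) (g : R -> R) (h : R -> \bar R) :
  has_density X g -> measurable_fun setT g -> (forall y, (0 <= g y)%R) ->
  measurable_fun setT h -> (forall y, 0 <= h y) ->
  \int[P]_w h (X w) = \int[lebesgue_measure]_y (h y * (g y)%:E).
Proof.
move=> Xg mg g0 mh h0.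
(* The law of [X] is transported to [measurableTypeR R], the copy of the line that carries Lebesgue
   measure. *)
have mX : measurable_fun setT (X : T -> measurableTypeR R).
  move=> _ B mB; have mB' : measurable (B : set R) by exact mB.
  exact: measurable_funPT X measurableT _ mB'.
pose nu' : {measure set (measurableTypeR R) -> \bar R} :=
  pushforward P (X : T -> measurableTypeR R).
pose nu := nu' mX.
rewrite -(@ge0_integral_density _ (measurableTypeR R) R lebesgue_measure nu)//.
by rewrite [RHS]ge0_integral_pushforward.
Qed.

Lemma measurable_expR_linear {R : realType} (t : R) :
  measurable_fun setT (fun y : R => (expR (t * y))%:E).
Proof.
by apply/measurable_EFinP; apply: measurableT_comp => //; exact: measurable_funM.
Qed.

(** * Exponential change of measure for one variable *)

Section tilting.
Context {R : realType} {sigma : R}.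
Hypothesis sigma_gt0 : (0 < sigma)%R.
Hypothesis total : \int[lebesgue_measure]_y (lognormal_pdf sigma y)%:E = 1.

Let mf := @measurable_lognormal_pdf R sigma.
Let f0 := lognormal_pdf_ge0 sigma_gt0.

Let measurable_integrand (s : R) :
  measurable_fun setT (fun y : R => (expR (- (s * y)) * lognormal_pdf sigma y)%:E).
Proof.
apply/measurable_EFinP; apply: measurable_funM => //.
by apply: measurableT_comp => //; exact: measurableT_comp.
Qed.

(** [fine] would turn an infinite integral into 0; for s >= 0 the integrand is dominated by the
    density, so the integral is finite and [laplace] is its true value. *)
Lemma laplaceE s : (0 <= s)%R ->
  \int[lebesgue_measure]_y (expR (- (s * y)) * lognormal_pdf sigma y)%:E =
  (laplace sigma s)%:E.
Proof.
move=> s0; rewrite /laplace integral_laplace fineK// ge0_fin_numE; last first.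
  by apply: integral_ge0 => y _; rewrite lee_fin mulr_ge0 ?expR_ge0.
apply: (@le_lt_trans _ _ 1); last by rewrite ltry.
rewrite -total; apply: ge0_le_integral => //.
- by move=> y _; rewrite lee_fin mulr_ge0 ?expR_ge0.
- exact: measurable_integrand.
- exact/measurable_EFinP.
- move=> y _; rewrite lee_fin; have [y0|y0] := ltP 0%R y.
    by rewrite ler_piMl// -expR0 ler_expR oppr_le0 mulr_ge0// ltW.
  by rewrite /lognormal_pdf ltNge y0/= mulr0.
Qed.

Lemma laplace_gt0 s : (0 <= s)%R -> (0 < laplace sigma s)%R.
Proof.
move=> s0; rewrite -lte_fin -laplaceE//.
have mh : measurable_fun setT (fun y : R => expR (- (s * y)) * lognormal_pdf sigma y)%R.
  by have /measurable_EFinP := measurable_integrand s.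
apply: (lt_le_trans (integral_itvoo_gt0 _ _ (@ltr01 R) mh _)).
  by move=> y y0; rewrite mulr_gt0 ?expR_gt0 ?lognormal_pdf_gt0.
apply: ge0_subset_integral => //; first exact: measurable_integrand.
by move=> y _; rewrite lee_fin mulr_ge0 ?expR_ge0.
Qed.

Lemma laplace0 : laplace sigma 0 = 1%R.
Proof.
apply: EFin_inj; rewrite -laplaceE// -total; apply: eq_integral => y _.
by rewrite mul0r oppr0 expR0 mul1r.
Qed.

Lemma tilted_pdfE theta y : (0 <= theta)%R -> tilted_pdf sigma theta y =
  (expR (- (theta * y)) * lognormal_pdf sigma y / laplace sigma theta)%R.
Proof.
move=> theta0; rewrite /tilted_pdf; case: ifPn => y0; last first.
  by rewrite /lognormal_pdf (negbTE y0) mulr0 mul0r.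
by rewrite expRD (expRN (kappa _ _)) /kappa lnK ?posrE ?laplace_gt0// mulrAC.
Qed.

Variable theta : R.
Hypothesis theta_ge0 : (0 <= theta)%R.
Local Notation L := (laplace sigma).
Let mg := @measurable_tilted_pdf R sigma theta.
Let g0 := tilted_pdf_ge0 sigma_gt0 theta.

(** Multiplying by e^(t y) lowers the tilt from theta to theta - t; t <= theta keeps it nonnegative,
    where [laplaceE] holds. *)
Lemma mgf_tilted d (T : measurableType d) (P : probability T R)
    (X : {RV P >-> R}) t :
  has_density X (tilted_pdf sigma theta) -> (t <= theta)%R ->
  \int[P]_w (expR (t * X w))%:E = (L (theta - t) / L theta)%:E.
Proof.
move=> Xg tle.
rewrite (@ge0_integral_has_density _ _ _ _ _ _ (fun y => (expR (t * y))%:E) Xg mg g0)//;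
  last exact: measurable_expR_linear.
rewrite [RHS]EFinM -laplaceE ?subr_ge0// muleC -ge0_integralZl//; last 3 first.
- exact: measurable_integrand.
- by move=> y _; rewrite lee_fin mulr_ge0 ?expR_ge0.
- by rewrite lee_fin invr_ge0 ltW// laplace_gt0.
apply: eq_integral => y _; rewrite tilted_pdfE// -!EFinM; congr (_%:E).
by rewrite mulrBl opprB expRD expRN; ring.
Qed.

(** Pointwise, the lognormal density is L(theta) e^(theta y) times the tilted one. *)
Lemma ge0_integral_tilt d (T : measurableType d) (P : probability T R)
    (X : {RV P >-> R}) d' (T' : measurableType d') (Q : probability T' R)
    (Y : {RV Q >-> R}) (h : R -> \bar R) :
  has_density X (tilted_pdf sigma theta) -> has_density Y (lognormal_pdf sigma) ->
  measurable_fun setT h -> (forall y, 0 <= h y) ->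
  \int[Q]_w h (Y w) = (L theta)%:E * \int[P]_w (h (X w) * (expR (theta * X w))%:E).
Proof.
move=> Xg Yf mh h0.
have mE := measurable_expR_linear theta.
have he0 y : 0 <= h y * (expR (theta * y))%:E by rewrite mule_ge0// lee_fin expR_ge0.
have mhe : measurable_fun setT (fun y : R => h y * (expR (theta * y))%:E).
  exact: emeasurable_funM.
rewrite (@ge0_integral_has_density _ _ _ _ _ _ _ Yf mf f0 mh h0) (@ge0_integral_has_density _ _ _ _ _ _ _ Xg mg g0 mhe he0).
rewrite -ge0_integralZl//; last 3 first.
- by apply: emeasurable_funM => //; exact/measurable_EFinP.
- by move=> y _; rewrite mule_ge0// lee_fin.
- by rewrite lee_fin ltW// laplace_gt0.
apply: eq_integral => y _; rewrite muleCA -[in RHS]muleA; congr (_ * _).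
rewrite -!EFinM; congr (_%:E); rewrite tilted_pdfE// expRN.
rewrite mulrCA mulrC; rewrite -!mulrA mulVKf ?gt_eqF ?expR_gt0//.
by rewrite mulVf ?mulr1// gt_eqF ?laplace_gt0.
Qed.

(** * Moment generating function and change of measure for sums *)

Section sums.
Context d (T : measurableType d) (P : probability T R) (X : nat -> {RV P >-> R}).
Hypothesis X_iid : iid_density X (tilted_pdf sigma theta).
Local Notation S := (partial_sum (fun i => X i : T -> R)).

Lemma mgf_partial_sum n t : (t <= theta)%R ->
  \int[P]_w (expR (t * S n w))%:E = ((L (theta - t) / L theta) ^+ n)%:E.
Proof.
case: X_iid => indep Xg tle; elim: n => [|n IH].
  under eq_integral do rewrite /partial_sum big_ord0 mulr0 expR0.
  by rewrite expr0 integral_cst//= probability_setT mule1.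
have e0 s : 0 <= (expR (t * s))%:E by rewrite lee_fin expR_ge0.
have /= -> := @ge0_integral_partial_sumS _ _ _ _ _ indep n _
  (measurable_expR_linear t) e0.
under eq_integral.
  move=> w _; under eq_integral do rewrite mulrDr expRD EFinM.
  rewrite ge0_integralZl//; last exact: (measurableT_comp (measurable_expR_linear t)).
  rewrite mgf_tilted//.
  over.
rewrite ge0_integralZr//; last 2 first.
- apply/measurable_EFinP; apply: measurableT_comp => //.
  by apply: measurable_funM => //; exact: measurable_partial_sum.
- by rewrite lee_fin divr_ge0// ltW// laplace_gt0 ?subr_ge0.
by rewrite IH -EFinM exprSr.
Qed.

(** Induction over all [h] at once: tilting the last variable turns [h] into the function [H] of the
    previous partial sum, to which the induction hypothesis applies. *)
Lemma ge0_integral_tilt_partial_sum d' (T' : measurableType d')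
    (Q : probability T' R) (Y : nat -> {RV Q >-> R}) n (h : R -> \bar R) :
  iid_density Y (lognormal_pdf sigma) ->
  measurable_fun setT h -> (forall y, 0 <= h y) ->
  \int[Q]_w h (partial_sum (fun i => Y i : T' -> R) n w) =
  (L theta ^+ n)%:E * \int[P]_w (h (S n w) * (expR (theta * S n w))%:E).
Proof.
case: X_iid => indepX Xg [indepY Yf]; elim: n h => [|n IH] h mh h0.
  under eq_integral do rewrite /partial_sum big_ord0.
  under [in RHS]eq_integral do rewrite /partial_sum big_ord0 mulr0 expR0 mule1.
  by rewrite expr0 mul1e !integral_cst//= !probability_setT.
have mE := measurable_expR_linear theta.
have he0 y : 0 <= h y * (expR (theta * y))%:E by rewrite mule_ge0// lee_fin expR_ge0.
have mhe : measurable_fun setT (fun y : R => h y * (expR (theta * y))%:E).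
  exact: emeasurable_funM.
rewrite (@ge0_integral_partial_sumS _ _ _ _ _ indepY _ _ mh h0).
have /= -> := @ge0_integral_partial_sumS _ _ _ _ _ indepX n _ mhe he0.
have mhs s : measurable_fun setT (fun y : R => h (s + y)%R).
  by apply: measurableT_comp => //; exact: measurable_funD.
pose H s := \int[P]_w (h (s + X n w)%R * (expR (theta * X n w))%:E).
have hs0 s y : 0 <= h (s + y)%R * (expR (theta * y))%:E.
  by rewrite mule_ge0// lee_fin expR_ge0.
have H0 s : 0 <= H s by exact: integral_ge0.
have mH : measurable_fun setT H.
  pose k (z : R * R) := h (z.1 + z.2)%R * (expR (theta * z.2))%:E.
  have mk : measurable_fun setT k.
    apply: emeasurable_funM; last exact: (measurableT_comp mE).
    by apply: (measurableT_comp mh); exact: measurable_funD.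
  rewrite [X in measurable_fun _ X](_ : _ = fubini_F (distribution P (X n)) k).
    by apply: measurable_fun_fubini_tonelli_F => // z; rewrite mule_ge0// lee_fin expR_ge0.
  apply/funext => s; rewrite /fubini_F ge0_integral_distribution//.
    exact: measurable_fun_pair2.
  by move=> y; exact: hs0.
under eq_integral.
  move=> w _; rewrite (@ge0_integral_tilt _ _ _ _ _ _ _ _ _ (Xg n) (Yf n) (mhs _))// -/(H _).
  over.
rewrite ge0_integralZl//; last 2 first.
- apply: (measurableT_comp mH); exact: measurable_partial_sum.
- by rewrite lee_fin ltW// laplace_gt0.
rewrite IH// muleA -EFinM -exprS; congr (_ * _).
apply: eq_integral => w _; rewrite muleC /H -ge0_integralZl//; last first.
  pose u y := h (S n w + y)%R * (expR (theta * y))%:E.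
  apply: (@measurableT_comp _ _ _ _ _ _ u); last exact: measurable_funPT.
  exact: emeasurable_funM.
apply: eq_integral => w' _; rewrite muleCA; congr (_ * _).
by rewrite -EFinM -expRD mulrDr.
Qed.

End sums.

End tilting.

(** * First-order expansion, convexity and elementary bounds *)

Lemma is_derive1_approx {R : realType} (k : R -> R) (a l : R) :
  is_derive a 1%R k l -> forall e, (0 < e)%R ->
  exists2 tau, (0 < tau)%R & forall t, (`|t| <= tau)%R ->
    (`|k (a - t) - k a + t * l| <= e * `|t|)%R.
Proof.
move=> [dk kl] e e0.
have : (fun h => h^-1 *: (k (h *: 1 + a) - k a))%R @ (0%R : R)^' --> l.
  by rewrite -kl; exact: dk.
move=> /cvgrPdist_le /(_ e e0) [tau/= tau0 H].
(* The limit gives an open ball; halving [tau] allows |t| <= tau in the conclusion. *)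
exists (tau / 2)%R; first by rewrite divr_gt0.
move=> t tle; have [->|t0] := eqVneq t 0%R.
  by rewrite subr0 subrr mul0r addr0 normr0 mulr0.
have := H (- t)%R; rewrite /ball_/= sub0r opprK oppr_eq0 => /(_ _ t0).
have -> : (`|t| < tau)%R by rewrite (le_lt_trans tle)// ltr_pdivrMr// ltr_pMr// ltr1n.
move=> /(_ isT); rewrite /GRing.scale/= mulr1 (addrC (- t)%R a) => Hle.
have -> : (k (a - t) - k a + t * l = t * (l - (- t)^-1 * (k (a - t) - k a)))%R.
  by rewrite invrN; field.
by rewrite normrM mulrC ler_wpM2r.
Qed.

(** The tangent of exp at l z lies below exp at z and at 0; in the combination with weights l and 1
    - l the linear terms cancel. *)
Lemma expR_convex_combination {R : realType} (l z : R) : (0 <= l <= 1)%R ->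
  (expR (l * z) <= l * expR z + (1 - l))%R.
Proof.
move=> /andP[l0 l1].
have H1 : (expR (l * z) * (1 + (1 - l) * z) <= expR z)%R.
  have -> : (expR z = expR (l * z) * expR ((1 - l) * z))%R.
    by rewrite -expRD; congr expR; ring.
  by rewrite ler_wpM2l ?expR_ge0// expR_ge1Dx.
have H2 : (expR (l * z) * (1 - l * z) <= 1)%R.
  rewrite -[leRHS](_ : (expR (l * z) * expR (- (l * z)))%R = _); last first.
    by rewrite -expRD subrr expR0.
  by rewrite ler_wpM2l ?expR_ge0// expR_ge1Dx.
have -> : (expR (l * z) = l * (expR (l * z) * (1 + (1 - l) * z)) +
   (1 - l) * (expR (l * z) * (1 - l * z)))%R by ring.
rewrite lerD ?ler_wpM2l// -[leRHS]mulr1 ler_wpM2l// subr_ge0//.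
Qed.

Lemma sum_seq_bounds {R : realDomainType} (s : seq nat) (a : nat -> R) (b : R) :
  {in s, forall i, 0 <= a i <= b}%R ->
  (0 <= \sum_(i <- s) a i <= (size s)%:R * b)%R.
Proof.
elim: s => [|i s IH] ab; first by rewrite big_nil mul0r lexx.
rewrite big_cons /= -natr1 mulrDl mul1r addrC.
have /andP[a0 al] := ab i (mem_head i s).
have /andP[s0 sl] : (0 <= \sum_(i <- s) a i <= (size s)%:R * b)%R.
  by apply: IH => j js; apply: ab; rewrite inE js orbT.
by apply/andP; split; [exact: addr_ge0|exact: lerD].
Qed.

Lemma prode_const_seq {R : realDomainType} (I : Type) (s : seq I) (p : R) :
  \prod_(i <- s) p%:E = (p ^+ size s)%:E.
Proof.
by elim: s => [|i s IH]; rewrite ?big_nil// big_cons IH/= exprS EFinM.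
Qed.

(** * Concentration of the sums under the tilted law *)

Section large_deviations.
Context {R : realType} {sigma theta x : R}.
Hypothesis sigma_gt0 : (0 < sigma)%R.
Hypothesis x_gt0 : (0 < x)%R.
Hypothesis theta_gt0 : (0 < theta)%R.
Hypothesis kappa' : is_derive theta 1%R (kappa sigma) (- x)%R.
Hypothesis total : \int[lebesgue_measure]_y (lognormal_pdf sigma y)%:E = 1.
Context d (T : measurableType d) (P : probability T R) (X : nat -> {RV P >-> R}).
Hypothesis X_iid : iid_density X (tilted_pdf sigma theta).
Local Notation S := (partial_sum (fun i => X i : T -> R)).
Local Notation L := (laplace sigma).
Local Notation K := (kappa sigma).

Let theta_ge0 := ltW theta_gt0.

(** For t <= theta, the moment generating function of X - x under the tilted law, written through
    [kappa] so that the derivative at [theta] can be used. *)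
Definition cmgf (t : R) : R := expR (K (theta - t) - K theta - t * x).

Let lapE s : (0 <= s)%R -> L s = expR (K s).
Proof. by move=> s0; rewrite /kappa lnK// posrE laplace_gt0. Qed.

Lemma centered_mgf n t : (t <= theta)%R ->
  \int[P]_w (expR (t * (S n w - n%:R * x)))%:E = (cmgf t ^+ n)%:E.
Proof.
move=> tle; under eq_integral do rewrite mulrBr expRD mulrC EFinM.
rewrite ge0_integralZl//; last first.
  apply/measurable_EFinP; apply: measurableT_comp => //.
  by apply: measurable_funM => //; exact: measurable_partial_sum.
rewrite (@mgf_partial_sum _ _ sigma_gt0 total _ theta_ge0 _ _ _ _ X_iid _ _ tle) -EFinM; congr (_%:E).
rewrite !lapE ?subr_ge0// -expRN -expRD -!expRM_natl -expRD; congr expR.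
by ring.
Qed.

(** Since kappa has derivative -x at theta, the logarithm of [cmgf] has derivative 0 at 0. The cap
    tau <= theta keeps theta - t nonnegative. *)
Lemma log_cmgf_near0 e : (0 < e)%R -> exists2 tau, (0 < tau <= theta)%R &
  forall t, (`|t| <= tau)%R -> (`|K (theta - t) - K theta - t * x| <= e * `|t|)%R.
Proof.
move=> e0; have [tau tau0 H] := is_derive1_approx _ _ _ kappa' _ e0.
exists (Num.min tau theta); first by rewrite lt_min tau0 theta_gt0 ge_min lexx orbT.
by move=> t; rewrite le_min => /andP[/H + _]; rewrite mulrN.
Qed.

(** Markov's inequality for e^(t (S_n - n x)); t may have either sign, so it serves both tails. *)
Lemma chernoff n t c (A : set T) : measurable A -> (t <= theta)%R ->
  (forall w, A w -> (c <= t * (S n w - n%:R * x))%R) ->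
  P A <= (expR (- c) * cmgf t ^+ n)%:E.
Proof.
move=> mA tle Ac; rewrite EFinM -centered_mgf//.
have mS : measurable_fun setT (S n) by exact: measurable_partial_sum.
rewrite -ge0_integralZl//; last first.
  apply/measurable_EFinP; apply: measurableT_comp => //.
  by apply: measurable_funM => //; exact: measurable_funB.
rewrite -[A]setIT -integral_indic//; apply: ge0_le_integral => //.
- exact/measurable_EFinP/measurable_indic.
- apply/measurable_EFinP; apply: measurable_funM => //.
  apply: measurableT_comp => //.
  by apply: measurable_funM => //; exact: measurable_funB.
move=> w _; rewrite -EFinM lee_fin indicE; case: (boolP (w \in A)) => [/[!inE] /Ac Hc|_].
  by rewrite -expRD -[leLHS](@expR0 R) ler_expR addrC subr_ge0.
by rewrite mulr_ge0 ?expR_ge0.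
Qed.

(** The threshold 1/4 lets two tails add up to at most 1/2. *)
Lemma expR_decay e : (0 < e)%R -> \forall n \near \oo, (expR (- (n%:R * e)) <= 4^-1 :> R)%R.
Proof.
move=> e0; near=> n.
have n4 : (ln 4 / e <= n%:R :> R)%R by near: n; exact: nbhs_infty_ger.
rewrite -[leRHS]lnK ?posrE// ler_expR lnV ?posrE// lerN2.
by rewrite -ler_pdivrMr.
Unshelve. all: by end_near. Qed.

(** Chernoff at t = tau and t = -tau: each tail gains e^(-n tau delta), and the expansion of log
    [cmgf] with error delta / 2 gives back at most half of that exponent. *)
Lemma weak_law delta : (0 < delta)%R -> \forall n \near \oo,
  2^-1%:E <= P (S n @^-1` `[n%:R * x - n%:R * delta, n%:R * x + n%:R * delta]%classic)%R.
Proof.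
move=> delta0; have [tau /andP[tau0 taule] H] := log_cmgf_near0 _ (divr_gt0 delta0 (ltr0Sn R 1)).
have e0 : (0 < tau * delta / 2)%R by rewrite divr_gt0// mulr_gt0.
have := expR_decay _ e0; apply: filterS => n decay.
set G := S n @^-1` _.
have mS : measurable_fun setT (S n) by exact: measurable_partial_sum.
have mG : measurable G by rewrite -[G]setTI; exact: mS.
pose A t : set T := [set w | (n%:R * tau * delta <= t * (S n w - n%:R * x))%R].
have mA t : measurable (A t).
  have mAt : measurable_fun setT
      (fun w => n%:R * tau * delta <= t * (S n w - n%:R * x))%R.
    apply: measurable_fun_ler => //; apply: measurable_funM => //.
    exact: measurable_funB.
  have mtrue : measurable [set true] by [].
  have := mAt measurableT _ mtrue; rewrite setTI.
  by congr measurable; apply/seteqP; split => w /=.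
have PA t : `|t|%R = tau -> P (A t) <= 4^-1%:E.
  move=> tE; have tle : (t <= theta)%R by rewrite (le_trans (ler_norm t))// tE.
  apply: (le_trans (chernoff n t (n%:R * tau * delta)%R (A t) (mA t) tle _)) => //.
  rewrite lee_fin; apply: le_trans decay.
  rewrite /cmgf -expRM_natl -expRD ler_expR.
  have := H t; rewrite tE lexx => /(_ isT) /(le_trans (ler_norm _)) Ht.
  have -> : (- (n%:R * (tau * delta / 2)) =
      - (n%:R * tau * delta) + n%:R * (delta / 2 * tau))%R by field.
  by rewrite lerD2l ler_wpM2l.
have sub : ~` G `<=` A tau `|` A (- tau)%R.
  move=> w; rewrite /G/= in_itv/= => /negP; rewrite negb_and -!ltNge => /orP[] Sw.
  - right; rewrite /A/= mulNr -mulrN opprB (mulrC n%:R) -mulrA ler_pM2l//.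
    by rewrite lerBrDl -lerBrDr ltW.
  - left; rewrite /A/= (mulrC n%:R) -mulrA ler_pM2l//.
    by rewrite lerBrDl ltW.
have : P (~` G) <= 4^-1%:E + 4^-1%:E.
  apply: le_trans (leeD (PA tau _) (PA (- tau)%R _)); last 2 first.
  - by rewrite gtr0_norm.
  - by rewrite normrN gtr0_norm.
  apply: (@le_trans _ _ (P (A tau `|` A (- tau)%R))); last exact: measureU2.
  by rewrite le_measure ?inE//; [exact: measurableC|exact: measurableU].
rewrite probability_setC// -EFinD.
have PG : P G \is a fin_num by rewrite fin_num_measure.
by rewrite -(fineK PG) -EFinB !lee_fin => ?; lra.
Qed.

(** * One summand: small values, convexity and the sign of the rate *)

Let mgf1 t : (t <= theta)%R ->
  \int[P]_w (expR (t * (X 0 w - x)))%:E = (cmgf t)%:E.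
Proof.
move=> /(centered_mgf 1) H; rewrite -[cmgf t]expr1 -H.
by under [in RHS]eq_integral do rewrite /partial_sum big_ord1 mul1r.
Qed.

Let mexp t : measurable_fun setT (fun w => (expR (t * (X 0 w - x)))%:E).
Proof.
apply/measurable_EFinP; apply: measurableT_comp => //.
by apply: measurable_funM => //; exact: measurable_funB.
Qed.

Let B : set R := `]0%R, (x / 2)%R[%classic.

(** The tilted density is positive on the interval, and it is the same for every [i]. *)
Lemma small_value_prob : exists2 p : R, (0 < p)%R &
  forall i, P (X i @^-1` `]0%R, (x / 2)%R[%classic) = p%:E.
Proof.
have [_ Xg] := X_iid.
have PXE i : P (X i @^-1` B) =
    \int[lebesgue_measure]_(y in B) (tilted_pdf sigma theta y)%:E.
  by have := Xg i B (measurable_itv _).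
have Bfin : P (X 0 @^-1` B) \is a fin_num.
  by apply: fin_num_measure; exact: measurable_funPTI (measurable_itv _).
exists (fine (P (X 0 @^-1` B))).
  rewrite -lte_fin fineK// PXE; apply: integral_itvoo_gt0.
  - by rewrite divr_gt0.
  - exact: measurable_tilted_pdf.
  - by move=> y; exact: tilted_pdf_gt0.
by move=> i; rewrite fineK// !PXE.
Qed.

(* By convexity [cmgf (l * theta / 2) <= 1 - l * (1 - cmgf (theta / 2))], so a value
   below 1 would contradict [cmgf' 0 = 0]. *)
Lemma cmgf_half_ge1 : (1 <= cmgf (theta / 2))%R.
Proof.
set a := (theta / 2)%R; have a0 : (0 < a)%R by rewrite divr_gt0.
have ale : (a <= theta)%R by rewrite /a ler_pdivrMr// ler_pMr// ler1n.
rewrite leNgt; apply/negP => ua1.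
(* Half the rate of descent of the chord from 0 to [a]: convexity gives cmgf t <= 1 - 2 e t, the
   expansion at 0 gives cmgf t >= 1 - e t. *)
pose e := ((1 - cmgf a) / (2 * a))%R.
have e0 : (0 < e)%R by rewrite divr_gt0// ?subr_gt0// mulr_gt0.
have [tau /andP[tau0 taule] H] := log_cmgf_near0 _ e0.
pose t := Num.min tau a; have t0 : (0 < t)%R by rewrite lt_min tau0.
have ta : (t <= a)%R by rewrite ge_min lexx orbT.
pose l := (t / a)%R.
have l01 : (0 <= l <= 1)%R by rewrite divr_ge0 ?(ltW t0) ?(ltW a0)//= ler_pdivrMr// mul1r.
have tE : t = (l * a)%R by rewrite /l divfK// gt_eqF.
have ut : (cmgf t <= l * cmgf a + (1 - l))%R.
  have [l0 l1] := andP l01.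
  rewrite -lee_fin -mgf1; last exact: le_trans ale.
  rewrite EFinD EFinM -mgf1// -ge0_integralZl//.
  rewrite -[(1 - l)%:E]mule1 -(probability_setT P) -integral_cst//.
  rewrite -ge0_integralD//; last 3 first.
  - by move=> w _; rewrite mule_ge0.
  - exact: measurable_funeM.
  - by move=> w _; rewrite lee_fin subr_ge0.
  apply: ge0_le_integral => //.
  - apply: emeasurable_funD => //; exact: measurable_funeM.
  move=> w _; rewrite -EFinM -EFinD lee_fin tE -mulrA.
  exact: expR_convex_combination.
have := H t; rewrite gtr0_norm// ge_min lexx => /(_ isT).
rewrite ler_norml => /andP[+ _] => Hlow.
have ut' : (1 - e * t <= cmgf t)%R.
  by apply: le_trans (expR_ge1Dx _); rewrite lerD2l.
have : (e * t = l * (1 - cmgf a) / 2)%R by rewrite /e /l; field; rewrite gt_eqF.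
have [l0 _] := andP l01.
have l0' : (0 < l)%R by rewrite divr_gt0.
move=> et; have : (1 - l * (1 - cmgf a) / 2 <= l * cmgf a + (1 - l))%R.
  by rewrite -et; exact: le_trans ut.
have : (0 < l * (1 - cmgf a))%R by rewrite mulr_gt0// subr_gt0.
by lra.
Qed.

(* With [W := expR (theta / 2 * (X - x))], the second moment of [W] is at least
   [2 * E W - 1 + E (W - 1) ^ 2], and [W] is away from 1 on an event of positive
   probability. *)
Lemma rate_lt0 : (K theta + theta * x < 0)%R.
Proof.
(* Since K 0 = 0, cmgf theta = e^(-(K theta + theta x)). *)
suff : (1 < cmgf theta)%R.
  rewrite /cmgf subrr -[ltLHS](@expR0 R) ltr_expR.
  have -> : K 0%R = 0%R by rewrite /kappa laplace0// ln1.
  by lra.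
set a := (theta / 2)%R; have a0 : (0 < a)%R by rewrite divr_gt0.
have ale : (a <= theta)%R by rewrite /a ler_pdivrMr// ler_pMr// ler1n.
have [p p0 pE] := small_value_prob.
(* Where X_0 < x / 2, W <= e^(-a x / 2) < 1, hence (1 - W)^2 >= c. *)
pose c := ((1 - expR (- (a * x / 2))) ^+ 2)%R.
have b1 : (expR (- (a * x / 2)) < 1)%R.
  by rewrite -[ltRHS](@expR0 R) ltr_expR oppr_lt0 divr_gt0// mulr_gt0.
have c0 : (0 < c)%R by rewrite exprn_gt0// subr_gt0.
have mB : measurable (X 0 @^-1` B) by exact: measurable_funPTI (measurable_itv _).
(* Integrates 2 W + c 1{X_0 in B} <= W^2 + 1; W^2 has mean cmgf theta because a = theta / 2. *)
have : (2 * cmgf a + c * p <= cmgf theta + 1)%R.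
  rewrite -lee_fin 2!EFinD 2!EFinM -!mgf1// -(probability_setT P).
  rewrite -[P setT]mul1e -integral_cst//.
  rewrite -(pE 0%N) -[X 0 @^-1` _]setIT -integral_indic//.
  rewrite -!ge0_integralZl//; [|exact/measurable_EFinP/measurable_indic|
    by rewrite lee_fin ltW].
  have mI : measurable_fun setT (fun w => c%:E * (\1_(X 0 @^-1` B) w : R)%:E).
    by apply: measurable_funeM; exact/measurable_EFinP/measurable_indic.
  have m2 : measurable_fun setT (fun w => 2%:E * (expR (a * (X 0 w - x)))%:E).
    exact: measurable_funeM.
  have I0 w : 0 <= c%:E * (\1_(X 0 @^-1` B) w : R)%:E.
    by rewrite mule_ge0// lee_fin ltW.
  have E0 w : 0 <= 2%:E * (expR (a * (X 0 w - x)))%:E by rewrite mule_ge0.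
  rewrite -!ge0_integralD//; apply: ge0_le_integral => //.
  - by move=> w _; exact: adde_ge0.
  - exact: emeasurable_funD.
  - exact: emeasurable_funD.
  move=> w _; rewrite -!EFinM -!EFinD lee_fin.
  have -> : (theta * (X 0 w - x) = a * (X 0 w - x) + a * (X 0 w - x))%R by rewrite /a; field.
  rewrite expRD; set W := expR _.
  rewrite indicE; case: (boolP (w \in _)) => [/[!inE] Bw|_]; last first.
    by rewrite mulr0 addr0; have := sqr_ge0 (W - 1)%R; rewrite expr2; lra.
  suff : (c <= (1 - W) ^+ 2)%R by rewrite mulr1 expr2; lra.
  have Wle : (W <= expR (- (a * x / 2)))%R.
    rewrite ler_expR -mulrA -mulrN ler_pM2l//.
    by move: Bw; rewrite /= in_itv/= => /andP[_ ?]; lra.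
  by rewrite ler_sqr ?nnegrE ?subr_ge0 ?lerD2l ?lerN2//; [exact: ltW|
    exact/ltW/(le_lt_trans Wle)].
have := cmgf_half_ge1; rewrite -/a; have : (0 < c * p)%R by rewrite mulr_gt0.
by lra.
Qed.

(* The sum of the first [n - n %/ r] variables concentrates slightly off its
   mean; forcing the last [n %/ r] ones below [x / 2] then pushes the total
   below [n * x] at a cost that is only exponential in [n / r]. *)
Lemma window_prob (p : R) (r : nat) : (1 < r)%N ->
  (forall i, P (X i @^-1` `]0%R, (x / 2)%R[%classic) = p%:E) ->
  \forall n \near \oo, (2^-1 * p ^+ (n %/ r))%:E <=
    P (S n @^-1` `[n%:R * (x - 2 * x / r%:R), n%:R * x[%classic)%R.
Proof.
move=> r1 pE; have r0 : (0 < r)%N by exact: ltnW.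
have rR : (0 < r%:R :> R)%R by rewrite ltr0n.
(* With this choice the deviation k delta is at most m x / 4, while the small values save at least m
   x / 2. *)
pose delta := (x / (8 * r%:R))%R.
have delta0 : (0 < delta)%R by rewrite divr_gt0// mulr_gt0.
have [N _ HN] := weak_law _ delta0.
(* n >= 2 N gives k >= N, as m <= n / 2; n >= r gives m >= 1. *)
exists (maxn (2 * N) r) => // n /=; rewrite geq_max => /andP[nN nr].
set m := (n %/ r)%N; pose k := (n - m)%N.
have m0 : (0 < m)%N by rewrite divn_gt0.
have mn2 : (m * 2 <= n)%N.
  by rewrite (leq_trans _ (leq_trunc_div n r))// leq_mul2l r1 orbT.
have nE : n = (k + m)%N by rewrite subnK// (leq_trans _ mn2)// leq_pmulr.
have kN : (N <= k)%N by rewrite /k; lia.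
have nmr : (n <= 2 * m * r)%N.
  rewrite (leq_trans (ltnW (ltn_ceil n r0)))// -/m leq_mul2r; apply/orP; right; lia.
have mrn : (m * r <= n)%N by exact: leq_trunc_div.
have := HN k kN; set G := S k @^-1` _ => PG.
have mG : measurable G.
  by rewrite -[G]setTI; apply: measurable_partial_sum => //; exact: measurable_itv.
set D := S n @^-1` _.
have mD : measurable D.
  by rewrite -[D]setTI; apply: measurable_partial_sum => //; exact: measurable_itv.
pose C := \big[setI/setT]_(i <- iota k m) (X i @^-1` B).
have mC : measurable C by apply: measurable_bigcap_preimage => i; exact: measurable_itv.
have PGC : P (G `&` C) = P G * (p ^+ m)%:E.
  have [indep _] := X_iid.
  rewrite (@independent_partial_sum _ _ _ _ _ indep k _ _ (fun=> B)).
  - by under eq_bigr do rewrite pE; rewrite prode_const_seq size_iota.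
  - exact: measurable_itv.
  - exact: iota_uniq.
  - by apply/allP => i; rewrite mem_iota => /andP[].
  - by move=> _; exact: measurable_itv.
have p0 : (0 <= p)%R by rewrite -lee_fin -(pE 0%N).
apply: (@le_trans _ _ (P (G `&` C))).
  by rewrite PGC EFinM lee_wpmul2r// lee_fin exprn_ge0.
rewrite le_measure ?inE//; first exact: measurableI.
move=> w [Gw Cw].
have Xw : {in iota k m, forall i, 0 <= X i w <= x / 2}%R.
  move=> i ikm; move: Cw; rewrite /C -bigcap_seq => /(_ i ikm).
  by rewrite /B/= in_itv/= => /andP[/ltW -> /ltW ->].
have /andP[lo up] := sum_seq_bounds _ _ _ Xw; rewrite size_iota in up.
have SE : S n w = (S k w + \sum_(i <- iota k m) X i w)%R.
  rewrite /partial_sum -!(big_mkord xpredT (fun i => X i w)) /index_iota !subn0.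
  by rewrite nE iotaD big_cat.
move: Gw; rewrite /G/= in_itv/= => /andP[Glo Gup].
have nER : (n%:R = k%:R + m%:R :> R)%R by rewrite nE natrD.
have kd : (k%:R * delta <= m%:R * x / 4)%R.
  apply: (@le_trans _ _ (n%:R * delta)%R); first by rewrite ler_pM2r// ler_nat leq_subr.
  rewrite /delta mulrA ler_pdivrMr ?mulr_gt0//.
  have -> : (m%:R * x / 4 * (8 * r%:R) = (2 * m * r)%:R * x)%R.
    by rewrite !natrM; field.
  by rewrite ler_pM2r// ler_nat.
have mx : (m%:R * x <= n%:R * (x / r%:R))%R.
  rewrite mulrA ler_pdivlMr// mulrAC ler_pM2r// -natrM ler_nat//.
have mx0 : (0 < m%:R * x)%R by rewrite mulr_gt0// ltr0n.
(* Lower end: S_n >= k x - m x / 4 = n x - 5 m x / 4, with m x <= n x / r. Upper end: S_n <= k x + m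
   x / 4 + m x / 2 < n x. *)
rewrite /D/= in_itv/= SE; apply/andP; split.
  rewrite mulrBr -mulrA (mulrCA n%:R) nER mulrDl -nER; lra.
rewrite nER mulrDl; lra.
Qed.

(** * The estimator: unbiasedness, variance and efficiency *)

Context d' (T' : measurableType d') (Q : probability T' R) (Y : nat -> {RV Q >-> R}).
Hypothesis Y_iid : iid_density Y (lognormal_pdf sigma).
Local Notation S' := (partial_sum (fun i => Y i : T' -> R)).
Local Notation beta := (beta_est sigma theta x (fun i => X i : T -> R)).

(** Given the first [n] variables, the last must hit a single point, which is null for a law with a
    density. *)
Lemma partial_sum_atomless n (c : R) : Q (S' n.+1 @^-1` [set c]) = 0.
Proof.
have [indep Yf] := Y_iid.
have mI (s : R) : measurable_fun setT (fun y : R => (\1_[set s] y : R)%:E).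
  by apply/measurable_EFinP; exact: measurable_indic.
have mSc : measurable (S' n.+1 @^-1` [set c]).
  by rewrite -[X in measurable X]setTI; apply: measurable_partial_sum.
rewrite -[S' n.+1 @^-1` _]setIT -integral_indic//.
transitivity (\int[Q]_w (\1_[set c] (S' n.+1 w) : R)%:E); first exact: eq_integral.
have I0 y : 0 <= (\1_[set c] y : R)%:E by rewrite lee_fin.
rewrite (@ge0_integral_partial_sumS _ _ _ _ _ indep n _ (mI c) I0).
apply: integral0_eq => w _.
transitivity (\int[Q]_w' (\1_(Y n @^-1` [set c - S' n w]%R) w' : R)%:E).
  apply: eq_integral => w' _; rewrite !indicE; congr ((nat_of_bool _)%:R%:E); apply/idP/idP.
    by rewrite !inE/= => <-; rewrite addrAC subrr add0r.
  by rewrite !inE/= => ->; rewrite addrC subrK.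
rewrite integral_indic//.
rewrite setIT; transitivity (distribution Q (Y n) [set c - S' n w]%R) => //.
by rewrite Yf// integral_set1.
Qed.

(** The change of measure is applied to the indicator of sums below n x. The boundary event S'_n = n
    x is null for n > 0, whereas for n = 0 it has full mass. *)
Lemma expectation_beta n : (0 < n)%N ->
  'E_P[beta n] = Q [set w | S' n w <= n%:R * x]%R.
Proof.
case: n => // n _; set m := n.+1.
have mS' : measurable_fun setT (S' m) by exact: measurable_partial_sum.
have mS : measurable_fun setT (S m) by exact: measurable_partial_sum.
pose J : set R := `]-oo, (m%:R * x)%R[%classic.
have mJ : measurable J by exact: measurable_itv.
have mh : measurable_fun setT (fun y : R => (\1_J y : R)%:E).
  by apply/measurable_EFinP; exact: measurable_indic.
have h0 y : 0 <= (\1_J y : R)%:E by rewrite lee_fin.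
have mSJ : measurable (S' m @^-1` J) by rewrite -[X in measurable X]setTI; exact: mS'.
have -> : [set w | S' m w <= m%:R * x]%R = S' m @^-1` J `|` S' m @^-1` [set m%:R * x]%R.
  apply/seteqP; split => w /=; rewrite /J/= in_itv/= le_eqVlt.
    by move=> /orP[/eqP|]; [right|left].
  by move=> [->|->]; rewrite ?orbT ?eqxx.
rewrite measureU//; last first.
  by apply/seteqP; split => w //= [+ E]; rewrite /J/= E in_itv/= ltxx.
transitivity (Q (S' m @^-1` J)); last first.
  by rewrite [X in _ + X](_ : _ = 0) ?adde0//; exact: partial_sum_atomless.
rewrite -[S' m @^-1` _]setIT -integral_indic//.
transitivity (\int[Q]_w (\1_J (S' m w) : R)%:E); last exact: eq_integral.
rewrite (@ge0_integral_tilt_partial_sum _ _ sigma_gt0 total _ theta_ge0 _ _ _ _ X_iid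
  _ _ _ _ _ _ Y_iid mh h0).
rewrite unlock -ge0_integralZl//; last 2 first.
- apply: emeasurable_funM; first exact: (measurableT_comp mh).
  apply/measurable_EFinP; apply: measurableT_comp => //.
  exact: measurable_funM.
- by rewrite lee_fin exprn_ge0// ltW// laplace_gt0.
apply: eq_integral => w _; rewrite -!EFinM; congr (_%:E).
rewrite /beta_est -mulrA; congr (_ * _)%R; rewrite mulrC; congr (_ * _)%R.
by rewrite indicE mem_setE in_itv.
Qed.

Lemma beta_bounds n w :
  (0 <= beta n w <= expR (n%:R * (K theta + theta * x)))%R.
Proof.
rewrite /beta_est lapE// -expRM_natl -expRD; case: ltP => Sw; last first.
  by rewrite mulr0 lexx expR_ge0.
rewrite mulr1 expR_ge0 ler_expR mulrDr lerD2l.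
by rewrite (mulrCA n%:R) ler_pM2l// ltW.
Qed.

Lemma measurable_beta n : measurable_fun setT (beta n).
Proof.
have mS : measurable_fun setT (S n) by exact: measurable_partial_sum.
apply: measurable_funM.
  apply: measurable_funM => //; apply: measurableT_comp => //.
  exact: measurable_funM.
apply: (measurableT_comp (f := fun b : bool => (b%:R : R))) => //.
exact: measurable_fun_ltr.
Qed.

Lemma expectation_beta_le n :
  'E_P[beta n] <= (expR (n%:R * (K theta + theta * x)))%:E.
Proof.
rewrite unlock -[leRHS]mule1 -(probability_setT P) -integral_cst//.
apply: ge0_le_integral => //.
- by move=> w _; have /andP[] := beta_bounds n w.
- by apply/measurable_EFinP; exact: measurable_beta.
- by move=> w _; have /andP[] := beta_bounds n w.
Qed.

(** The estimator and its mean both lie between 0 and e^(n rho), so their difference is at most e^(n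
    rho) in absolute value. *)
Lemma variance_beta_le n :
  0 <= 'V_P[beta n] <= (expR (n%:R * (K theta + theta * x)) ^+ 2)%:E.
Proof.
rewrite /variance covariance.unlock expectation.unlock.
set c := fine _; set b := expR _.
have E0 : 0 <= 'E_P[beta n].
  by rewrite unlock; apply: integral_ge0 => w _; rewrite lee_fin; have /andP[] := beta_bounds n w.
have Efin : 'E_P[beta n] \is a fin_num.
  by rewrite ge0_fin_numE// (le_lt_trans (expectation_beta_le n))// ltry.
have /andP[c0 cb] : (0 <= c <= b)%R.
  have -> : c = fine 'E_P[beta n] by rewrite unlock.
  by rewrite fine_ge0//= -lee_fin fineK// expectation_beta_le.
rewrite [X in 0 <= X <= _](_ : _ = \int[P]_w ((beta n w - c) ^+ 2)%:E)//.
apply/andP; split; first by apply: integral_ge0 => w _; rewrite lee_fin sqr_ge0.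
rewrite -[leRHS]mule1 -(probability_setT P) -integral_cst//.
apply: ge0_le_integral => //.
- by move=> w _; rewrite lee_fin sqr_ge0.
- apply/measurable_EFinP; apply: measurable_funX; apply: measurable_funB => //.
  exact: measurable_beta.
move=> w _; rewrite lee_fin.
have /andP[bl bu] := beta_bounds n w.
have : (`|beta n w - c| <= b)%R by rewrite ler_norml; apply/andP; split; rewrite -/b in bu; lra.
by move=> ?; rewrite /= -[leLHS]real_normK ?num_real// ler_sqr// ?nnegrE ?expR_ge0.
Qed.

(** On the window of [window_prob] the estimator is at least [b], so its mean is at least [b] times
    the probability of the window. *)
Lemma expectation_beta_ge eta : (0 < eta)%R -> \forall n \near \oo,
  (expR (n%:R * (K theta + theta * x - eta)))%:E <= 'E_P[beta n].
Proof.
move=> eta0; have [p p0 pE] := small_value_prob.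
have p1 : (p <= 1)%R by rewrite -lee_fin -(pE 0%N) probability_le1//; exact: measurable_funPTI (measurable_itv _).
have lnp : (ln p <= 0)%R by rewrite -ln1 ler_ln ?posrE.
(* c / r is the loss in the exponent per variable: 2 theta x / r from the lower end of the window,
   -ln p / r from the forced small values. *)
pose c := (2 * theta * x - ln p)%R.
have c0 : (0 <= c)%R by rewrite subr_ge0 (le_trans lnp)// ltW// !mulr_gt0.
(* r > 2 c / eta leaves half of [eta] to absorb the factor 1/2; the second successor ensures r > 1,
   as [window_prob] requires. *)
pose r := (Num.truncn (2 * c / eta)).+2.
have rR : (0 < r%:R :> R)%R by rewrite ltr0n.
have cr : (c / r%:R <= eta / 2)%R.
  have : (2 * c / eta < r%:R)%R.
    by rewrite (lt_trans (truncnS_gt _))// ltr_nat.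
  rewrite ltr_pdivrMr// ler_pdivrMr// => ?; lra.
have eta20 : (0 < eta / 2)%R by rewrite divr_gt0.
near=> n.
have n0 : (0 < n)%N by near: n; exact: nbhs_infty_gt.
have win : (2^-1 * p ^+ (n %/ r))%:E <=
    P (S n @^-1` `[n%:R * (x - 2 * x / r%:R), n%:R * x[%classic)%R.
  by near: n; exact: window_prob.
have dec : (expR (- (n%:R * (eta / 2))) <= 2^-1 :> R)%R.
  apply: (@le_trans _ _ (4^-1)%R); first by near: n; exact: expR_decay.
  by rewrite lef_pV2 ?posrE// ler_nat.
have mS : measurable_fun setT (S n) by exact: measurable_partial_sum.
set D := S n @^-1` _ in win.
have mD : measurable D by rewrite -[D]setTI; apply: mS => //; exact: measurable_itv.
pose b := expR (n%:R * K theta + theta * (n%:R * (x - 2 * x / r%:R))).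
have b0 : 0 <= b%:E by rewrite lee_fin expR_ge0.
have bD : b%:E * P D <= 'E_P[beta n].
  rewrite unlock -[D]setIT -integral_indic// -ge0_integralZl//; last first.
    exact/measurable_EFinP/measurable_indic.
  apply: ge0_le_integral => //.
  - by move=> w _; rewrite mule_ge0.
  - by apply: measurable_funeM; exact/measurable_EFinP/measurable_indic.
  - by apply/measurable_EFinP; exact: measurable_beta.
  move=> w _; rewrite -EFinM lee_fin indicE.
  case: (boolP (w \in D)) => [|_]; last first.
    by rewrite mulr0; have /andP[] := beta_bounds n w.
  rewrite inE /D/= in_itv/= => /andP[lo up].
  rewrite /beta_est up !mulr1 lapE// -expRM_natl -expRD ler_expR lerD2l.
  by rewrite ler_pM2l.
apply: le_trans bD; apply: (@le_trans _ _ (b%:E * (2^-1 * p ^+ (n %/ r))%:E)); last first.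
  by rewrite lee_wpmul2l// lee_fin expR_ge0.
rewrite -EFinM lee_fin -[p]lnK ?posrE// -expRM_natl.
apply: (@le_trans _ _ (b * (expR (- (n%:R * (eta / 2))) * expR ((n %/ r)%:R * ln p)))%R); last first.
  by rewrite ler_wpM2l ?expR_ge0// ler_wpM2r ?expR_ge0.
rewrite /b -!expRD ler_expR.
have nr : ((n %/ r)%:R <= n%:R / r%:R :> R)%R.
  by rewrite ler_pdivlMr// -natrM ler_nat leq_trunc_div.
have H1 : (n%:R / r%:R * ln p <= (n %/ r)%:R * ln p)%R by rewrite ler_wnM2r.
have H2 : (n%:R * (c / r%:R) <= n%:R * (eta / 2))%R by rewrite ler_wpM2l.
have H3 : (n%:R * (c / r%:R) = theta * (n%:R * (2 * x / r%:R)) - n%:R / r%:R * ln p)%R.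
  by rewrite /c; field; rewrite gt_eqF.
rewrite H3 in H2; rewrite !mulrBr !mulrDr.
rewrite (mulrCA n%:R theta x); lra.
Unshelve. all: by end_near. Qed.

Lemma beta_log_efficient eps : (0 < eps)%R ->
  limn_esup (fun n : nat =>
    ('V_P[beta n] *
     ((fine (Q [set w | S' n w <= n%:R * x]%R) `^ (2 - eps))^-1)%:E)%E) = 0%E.
Proof.
move=> eps0; set rho := (K theta + theta * x)%R.
have rho0 : (rho < 0)%R by exact: rate_lt0.
(* The cap at 1 keeps 2 - e positive, so that the power is monotone in its base; as a <= 1, a^(2 -
   e) <= a^(2 - eps), and [e] can replace [eps]. *)
pose e := Num.min eps 1%R.
have e0 : (0 < e)%R by rewrite lt_min eps0 ltr01.
have e1 : (e <= 1)%R by rewrite ge_min lexx orbT.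
have eeps : (e <= eps)%R by rewrite ge_min lexx.
have erho : (e * rho < 0)%R by rewrite pmulr_rlt0.
(* The final exponent is n times e rho + (2 - e) eta <= e rho + 2 eta = e rho / 2, the logarithm of
   [z]. *)
pose eta := (- (e * rho) / 4)%R.
have eta0 : (0 < eta)%R by rewrite divr_gt0// oppr_gt0.
pose z := expR (e * rho / 2).
have z1 : (`|z| < 1)%R.
  rewrite ger0_norm ?expR_ge0// -[ltRHS](@expR0 R) ltr_expR.
  by rewrite pmulr_llt0// invr_gt0.
have zcvg : (fun n => (z ^+ n)%:E) @ \oo --> (0%R : R)%:E.
  by apply: cvg_EFin; [exact: nearW|exact: cvg_expr].
(* The limsup is a limit, obtained by squeezing the ratio between 0 and z^n. *)
apply: (cvg_limn_einf_sup _).2.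
apply: (squeeze_cvge _ (cvg_cst _) zcvg).
near=> n.
have n0 : (0 < n)%N by near: n; exact: nbhs_infty_gt.
have n0R : (0 <= n%:R :> R)%R by [].
have low : (expR (n%:R * (rho - eta)))%:E <= 'E_P[beta n].
  by near: n; exact: expectation_beta_ge.
have /andP[V0 V1] := variance_beta_le n.
rewrite expectation_beta// in low.
set alpha := Q _ in low *.
have mA : measurable [set w | S' n w <= n%:R * x]%R.
  rewrite (_ : [set _ | _] = S' n @^-1` `]-oo, (n%:R * x)%R]%classic).
    by rewrite -[X in measurable X]setTI; apply: measurable_partial_sum => //; exact: measurable_itv.
  by apply/seteqP; split => w /=; rewrite in_itv.
have afin : alpha \is a fin_num by rewrite fin_num_measure.
have a1 : (fine alpha <= 1)%R by rewrite -lee_fin fineK// probability_le1.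
rewrite -(fineK afin) lee_fin in low.
set a := fine alpha in low a1 *.
have a0 : (0 < a)%R by apply: lt_le_trans low; exact: expR_gt0.
have pa0 : (0 < a `^ (2 - eps))%R by rewrite powR_gt0.
have pow : (expR (n%:R * (rho - eta) * (2 - e)) <= a `^ (2 - eps))%R.
  apply: (@le_trans _ _ (a `^ (2 - e))%R).
    rewrite expRM; apply: ge0_ler_powR; rewrite ?nnegrE ?expR_ge0 ?(ltW a0)//.
    by rewrite subr_ge0 (le_trans e1)// ler1n.
  by apply: ger_powR; rewrite ?a0 ?a1// lerD2l lerN2.
apply/andP; split.
  by rewrite mule_ge0// lee_fin invr_ge0 ltW.
apply: (@le_trans _ _ ((expR (n%:R * rho) ^+ 2) * (expR (n%:R * (rho - eta) * (2 - e)))^-1)%:E)%R.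
  rewrite EFinM; apply: lee_pmul => //; first by rewrite lee_fin invr_ge0 ltW.
  by rewrite lee_fin lef_pV2 ?posrE ?expR_gt0.
rewrite lee_fin -expRN -expRM_natl -expRD /z -expRM_natl ler_expR.
have -> : (2 * (n%:R * rho) + - (n%:R * (rho - eta) * (2 - e)) =
  n%:R * (e * rho + (2 - e) * eta))%R by ring.
rewrite ler_wpM2l//.
have : (e * eta >= 0)%R by rewrite mulr_ge0// ltW.
have : (4 * eta = - (e * rho))%R by rewrite /eta; field.
by lra.
Unshelve. all: by end_near. Qed.

End large_deviations.

(** Supplies the hypothesis [total]: the law of [Y 0] has mass 1, so the lognormal density
    integrates to 1. *)
Lemma integral_density_setT {R : realType} d (T : measurableType d)
    (P : probability T R) (X : {RV P >-> R}) (g : R -> R) :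
  has_density X g -> \int[lebesgue_measure]_y (g y)%:E = 1.
Proof.
move=> /(_ setT measurableT) <-.
by rewrite /distribution /pushforward preimage_setT probability_setT.
Qed.

Theorem theorem4p1 (R : realType) (sigma x theta : R) :
  (0 < sigma)%R -> (0 < x)%R -> (x < expR (sigma ^+ 2 / 2))%R ->
  (0 < theta)%R -> is_derive theta 1%R (kappa sigma) (- x)%R ->
  forall (d : measure_display) (T : measurableType d) (P : probability T R)
         (X : nat -> {RV P >-> R}),
  iid_density X (tilted_pdf sigma theta) ->
  forall (d' : measure_display) (T' : measurableType d') (Q : probability T' R)
         (Y : nat -> {RV Q >-> R}),
  iid_density Y (lognormal_pdf sigma) ->
  (forall n : nat, (0 < n)%N ->
     'E_P[beta_est sigma theta x (fun i => X i : T -> R) n]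
     = Q [set w | partial_sum (fun i => Y i : T' -> R) n w <= n%:R * x]%R)
  /\
  (forall eps : R, (0 < eps)%R ->
     limn_esup (fun n : nat =>
       ('V_P[beta_est sigma theta x (fun i => X i : T -> R) n]
        * ((fine (Q [set w | partial_sum (fun i => Y i : T' -> R) n w
                              <= n%:R * x]%R) `^ (2 - eps))^-1)%:E)%E) = 0%E).
Proof.
move=> sigma_gt0 x_gt0 _ theta_gt0 kappa' d T P X X_iid d' T' Q Y Y_iid.
have total := integral_density_setT _ _ _ _ _ (Y_iid.2 0%N).
split; first by move=> n; exact: expectation_beta.
by move=> eps; exact: beta_log_efficient.
Qed.
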